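(* Let $(\mathcal{A},\tau)$ be a $C^*$-probability space, let $k\ge 1$, and let $a_1,\dots,a_k\in\mathcal{A}$ be free random variables. Put $a:=a_1a_2\cdots a_k$. Then for every $n\ge 1$ the $n$-th free cumulant $\kappa_n(a):=\kappa_n(a,\dots,a)$ and the $n$-th moment of $a$ are given by $$\kappa_n(a)=\sum_{\pi\in NC_k(n)}\kappa_{Kr(\pi)}(a_1,\dots,a_k),\qquad \tau(a^n)=\sum_{\pi\in NC^k(n)}\kappa_{Kr(\pi)}(a_1,\dots,a_k),$$ where, for $\sigma\in NC(kn)$, $\kappa_\sigma(a_1,\dots,a_k)$ denotes $\kappa_\sigma$ evaluated at the sequence of length $kn$ obtained by repeating $(a_1,\dots,a_k)$ $n$ times, i.e. $\kappa_\sigma(a_1,\dots,a_k,a_1,\dots,a_k,\dots,a_1,\dots,a_k)$.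
   Context: A $C^*$-probability space is a pair $(\mathcal{A},\tau)$ with $\mathcal{A}$ a unital $C^*$-algebra and $\tau:\mathcal{A}\to\mathbb{C}$ a positive unital linear functional. Partitions: a partition $\pi$ of a finite totally ordered set $S$ is non-crossing if whenever $a<b<c<d$ in $S$ with $a,c$ in a block $V$ and $b,d$ in a block $W$, then $V=W$. $NC(S)$ is the set of non-crossing partitions of $S$ and $NC(n)=NC([n])$, $[n]=\{1,\dots,n\}$. $NC(S)$ is ordered by reverse refinement: $\pi\preceq\sigma$ iff every block of $\pi$ is contained in a block of $\sigma$; it is a lattice. $NC^k(n)$ is the set of $k$-divisible partitions in $NC(kn)$ (all block sizes are multiples of $k$); $NC_k(n)$ is the set of $k$-equal partitions in $NC(kn)$ (all blocks have size exactly $k$). Kreweras complement: for $\pi,\sigma\in NC(n)$ let $\pi\cup\sigma$ be the partition of $[2n]$ obtained by placing $\pi$ on $\{1,3,\dots,2n-1\}$ (element $i$ at $2i-1$) and $\sigma$ on $\{2,4,\dots,2n\}$ (element $i$ at $2i$). Then $Kr(\pi)$ is the largest $\sigma\in NC(n)$ such that $\pi\cup\sigma\in NC(2n)$. Free cumulants: the multilinear functionals $\kappa_n:\mathcal{A}^n\to\mathbb{C}$, $n\ge1$, are defined recursively by $\tau(x_1\cdots x_n)=\sum_{\pi\in NC(n)}\kappa_\pi(x_1,\dots,x_n)$, where for $\pi=\{V_1,\dots,V_i\}$ one sets $\kappa_\pi(x_1,\dots,x_n)=\prod_{j=1}^i\kappa_{|V_j|}(x_{m_1},\dots,x_{m_{|V_j|}})$,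 with $V_j=\{m_1<\dots<m_{|V_j|}\}$. Elements $a_1,\dots,a_k\in\mathcal{A}$ are free iff for all $n$ and $1\le i_1,\dots,i_n\le k$, $\kappa_n(a_{i_1},\dots,a_{i_n})=0$ unless $i_1=\dots=i_n$. *)

(* Defs.v *)
From HB Require Import structures.
From mathcomp Require Import all_boot all_order all_algebra.
From mathcomp Require Import all_classical all_reals all_analysis.
From mathcomp Require Import complex.
Set Implicit Arguments. Unset Strict Implicit. Unset Printing Implicit Defensive.
Import Order.TTheory GRing.Theory Num.Theory.
Import numFieldNormedType.Exports.
Local Open Scope ring_scope.
Local Open Scope complex_scope.

(* The library has no join of rings with normed modules: ring and norm meet in
   numDomainType, which forces commutativity and an order. So the norm is a
   field of the structure, and completeness is convergence of Cauchy
   sequences. *)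
HB.mixin Record isCStarAlgebra (R : realType) A of GRing.Algebra R[i] A := {
  cstar_norm : A -> R ;
  cstar_normD : forall x y,
    cstar_norm (x + y) <= cstar_norm x + cstar_norm y ;
  cstar_normZ : forall (c : R[i]) x,
    (cstar_norm (c *: x))%:C = `|c| * (cstar_norm x)%:C ;
  cstar_norm_eq0 : forall x, cstar_norm x = 0 -> x = 0 ;
  cstar_normM : forall x y,
    cstar_norm (x * y) <= cstar_norm x * cstar_norm y ;
  cstar_complete : forall u : nat -> A,
    (forall e : R, 0 < e ->
       exists N, forall m n, (N <= m)%N -> (N <= n)%N ->
         cstar_norm (u m - u n) < e) ->
    exists l : A, (cstar_norm (u n - l) @[n --> \oo] --> (0 : R))%classic ;
  star : A -> A ;
  starK : forall x, star (star x) = x ;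
  starD : forall x y, star (x + y) = star x + star y ;
  starZ : forall (c : R[i]) x, star (c *: x) = c^* *: star x ;
  starM : forall x y, star (x * y) = star y * star x ;
  cstar_identity : forall x, cstar_norm (star x * x) = cstar_norm x ^+ 2
}.

#[short(type="cstarAlgType")]
HB.structure Definition CStarAlgebra (R : realType) :=
  {A of GRing.Algebra R[i] A & isCStarAlgebra R A}.

(* [0 <= z] in R[i] means that z is real and nonnegative. *)
Record cstarProbSpace (R : realType) := CStarProbSpace {
  cps_alg :> cstarAlgType R ;
  cps_state : {scalar cps_alg} ;
  cps_state_ge0 : forall x : cps_alg, 0 <= cps_state (star x * x) ;
  cps_state1 : cps_state 1 = 1
}.

(* [n] is represented by 'I_n, so all indices are shifted down by one. *)
Definition noncrossing (n : nat) (P : {set {set 'I_n}}) : bool :=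
  [forall V in P, forall W in P,
    forall a : 'I_n, forall b : 'I_n, forall c : 'I_n, forall d : 'I_n,
    [&& (a < b)%N, (b < c)%N, (c < d)%N,
        a \in V, c \in V, b \in W & d \in W] ==> (V == W)].

Definition NC (n : nat) : {set {set {set 'I_n}}} :=
  [set P | finset.partition P [set: 'I_n] & noncrossing P].

Definition refines (n : nat) (P Q : {set {set 'I_n}}) : bool :=
  [forall V in P, exists W in Q, V \subset W].

Definition NC_divisible (k n : nat) : {set {set {set 'I_(k * n)}}} :=
  [set P in NC (k * n) | [forall V in P, (k %| #|V|)%N]].

Definition NC_equal (k n : nat) : {set {set {set 'I_(k * n)}}} :=
  [set P in NC (k * n) | [forall V in P, #|V| == k]].

Lemma odd_place_subproof (n : nat) (i : 'I_n) : (2 * i < 2 * n)%N.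
Proof. by rewrite ltn_pmul2l. Qed.

Lemma even_place_subproof (n : nat) (i : 'I_n) : ((2 * i).+1 < 2 * n)%N.
Proof. by rewrite !mul2n -doubleS leq_double. Qed.

(* In 1-based terms, [odd_place] sends i to 2i - 1 and [even_place] sends i
   to 2i. *)
Definition odd_place (n : nat) (i : 'I_n) : 'I_(2 * n) :=
  Ordinal (odd_place_subproof i).
Definition even_place (n : nat) (i : 'I_n) : 'I_(2 * n) :=
  Ordinal (even_place_subproof i).

Definition interleave (n : nat) (P Q : {set {set 'I_n}}) :
    {set {set 'I_(2 * n)}} :=
  [set @odd_place n @: (V : {set 'I_n}) | V in P] :|:
  [set @even_place n @: (W : {set 'I_n}) | W in Q].

Definition Kr_candidates (n : nat) (P : {set {set 'I_n}}) :
    {set {set {set 'I_n}}} :=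
  [set Q in NC n | interleave P Q \in NC (2 * n)].

(* The largest candidate for the order [refines]; the default value set0 is
   only taken when there is no largest one, which does not happen for P in
   NC n. *)
Definition Kr (n : nat) (P : {set {set 'I_n}}) : {set {set 'I_n}} :=
  odflt finset.set0
    [pick Q in Kr_candidates P | [forall Q' in Kr_candidates P, refines Q' Q]].

Section FreeCumulants.
Variables (C : comNzRingType) (A : nzRingType) (tau : A -> C).
Implicit Types (s : seq A).

(* [enum V] lists a block V in increasing order. *)
Definition multiplicative_ext (kappa : seq A -> C) (n : nat)
    (P : {set {set 'I_n}}) s : C :=
  \prod_(V in P) kappa [seq s`_i | i : 'I_n <- enum V].

(* The moment-cumulant relation solved for the term of the one-block
   partition; m bounds the recursion depth, and any m >= size s > 0 gives the
   same value. Only nonempty sequences are meaningful arguments. *)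
Fixpoint free_cumulant_rec (m : nat) s : C :=
  if m is m'.+1 then
    tau (\prod_(x <- s) x) -
    \sum_(P in NC (size s) | P != [set [set: 'I_(size s)]]%SET)
       multiplicative_ext (free_cumulant_rec m') P s
  else 0.

Definition free_cumulant s : C := free_cumulant_rec (size s) s.

Definition free_cumulant_part (n : nat) (P : {set {set 'I_n}}) s : C :=
  multiplicative_ext free_cumulant P s.

Definition freely_independent (k : nat) (a : k.-tuple A) : Prop :=
  forall i : seq 'I_k, ~~ constant i ->
    free_cumulant [seq tnth a j | j <- i] = 0.

End FreeCumulants.

Section MomentCumulant.
Variables (C : comNzRingType) (A : nzRingType) (tau : A -> C).

Lemma NC_block_lt (n : nat) (P : {set {set 'I_n}}) (V : {set 'I_n}) :
  P \in NC n -> P != [set [set: 'I_n]]%SET -> V \in P -> (#|V| < n)%N.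
Proof.
rewrite inE => /andP[partP _] neP VP; rewrite -[X in (_ < X)%N]card_ord.
rewrite ltn_neqAle max_card andbT; apply: contra neP => /eqP cV.
have VT : V = [set: 'I_n]%SET.
  by apply/eqP; rewrite eqEcard finset.subsetT cardsT cV /=.
have /and3P[_ /finset.trivIsetP tP P0] := partP.
apply/eqP/finset.setP => W; rewrite inE; apply/idP/eqP => [WP|->]; last by rewrite -VT.
apply/eqP/negPn/negP => neW.
have := tP W V WP VP; rewrite VT => /(_ neW).
rewrite -finset.setI_eq0 finset.setIT => /eqP W0.
by rewrite W0 (negPf P0) in WP.
Qed.

Lemma NC_block_gt0 (n : nat) (P : {set {set 'I_n}}) (V : {set 'I_n}) :
  P \in NC n -> V \in P -> (0 < #|V|)%N.
Proof.
rewrite inE => /andP[/and3P[_ _ P0] _] VP.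
by rewrite card_gt0; apply: contraNneq P0 => <-.
Qed.

Lemma free_cumulant_recE (m : nat) (s : seq A) :
  (size s <= m)%N -> (0 < size s)%N ->
  free_cumulant_rec tau m s = free_cumulant tau s.
Proof.
suff H N : forall m1 m2 (s : seq A), (size s <= N)%N -> (0 < size s)%N ->
    (size s <= m1)%N -> (size s <= m2)%N ->
    free_cumulant_rec tau m1 s = free_cumulant_rec tau m2 s.
  by move=> sm s0; exact: (H (size s)).
elim: N => [|N IH] m1 m2 {}s; first by case: (size s).
case: m1 m2 => [|m1] [|m2] sN s0 s1 s2.
- by have := leq_trans s0 s1.
- by have := leq_trans s0 s1.
- by have := leq_trans s0 s2.
rewrite /=; congr (_ - _); apply: eq_bigr => P /andP[PNC Pne].
apply: eq_bigr => V VP.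
have lt := NC_block_lt PNC Pne VP.
have V0 := NC_block_gt0 PNC VP.
by apply: IH; rewrite size_map -cardE // -ltnS; exact: (leq_trans lt).
Qed.

Lemma NC_one_block (n : nat) :
  (0 < n)%N -> [set [set: 'I_n]]%SET \in NC n.
Proof.
move=> n0; rewrite inE; apply/andP; split; last first.
  apply/forall_inP => V /finset.set1P ->; apply/forall_inP => W /finset.set1P ->.
  by do 4!apply/forallP => ?; rewrite eqxx implybT.
apply/and3P; split.
- by rewrite /finset.cover big_set1.
- by apply/finset.trivIsetP => V W /finset.set1P -> /finset.set1P ->; rewrite eqxx.
- by rewrite inE eq_sym -card_gt0 cardsT card_ord.
Qed.

(* The defining relation of the free cumulants. *)
Lemma moment_cumulant (s : seq A) : (0 < size s)%N ->
  tau (\prod_(x <- s) x) =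
  \sum_(P in NC (size s)) free_cumulant_part tau P s.
Proof.
move=> s0; rewrite (bigD1 [set [set: 'I_(size s)]]%SET) ?NC_one_block //=.
rewrite /free_cumulant_part {1}/multiplicative_ext big_set1.
have -> : [seq s`_i | i : 'I_(size s) <- enum [set: 'I_(size s)]%SET] = s.
  rewrite enum_setT -enumT (map_comp (nth 0 s) val) val_enum_ord.
  exact: mkseq_nth.
have -> : free_cumulant tau s = tau (\prod_(x <- s) x) -
    \sum_(P in NC (size s) | P != [set [set: 'I_(size s)]]%SET)
       multiplicative_ext (free_cumulant tau) P s.
  rewrite -[LHS](free_cumulant_recE (leqnSn _) s0) /=; congr (_ - _).
  apply: eq_bigr => P /andP[PNC Pne]; apply: eq_bigr => V VP.
  apply: free_cumulant_recE; rewrite size_map -cardE.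
    exact: ltnW (NC_block_lt PNC Pne VP).
  exact: NC_block_gt0 PNC VP.
by rewrite subrK.
Qed.

End MomentCumulant.

(* Main.v *)
Require Import Defs.
From mathcomp Require Import all_classical all_reals all_analysis.
From mathcomp Require Import complex.
From mathcomp Require Import all_boot all_order all_algebra.
From mathcomp Require Import zify.
Set Implicit Arguments. Unset Strict Implicit. Unset Printing Implicit Defensive.
Import Order.TTheory GRing.Theory Num.Theory.

(** Number the positions of the word a_1 ... a_k repeated n times from 0 to
kn - 1. The moment-cumulant formula writes tau(a^n) as the sum of
kappa_sigma over all sigma in NC(kn), and freeness kills every sigma having a
block that meets two residue classes modulo k. Both formulas come from
reindexing this sum by sigma = Kr(pi).

The Kreweras complement is handled through a parity condition. Call {x, y} and
{i, j} unlinked when the number of pairs (z, t), z in {x, y} and t in {i, j},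
with z <= t is even; placing x on odd and i on even places, this says that the
two chords do not cross. Being a relation between pairs of positions, it defines a Galois
connection on partitions, and for every pi the relation of being unlinked from
all pairs of pi is a non-crossing equivalence: it is the Kreweras complement
([Kr_kreweras]). For pi non-crossing, applying the dual construction to the
complement gives pi back ([kreweras_dual]), because consecutive elements v < v'
of a block of pi force v and v' - 1 into one block of the complement
([kreweras_gap]), and likewise cyclically ([kreweras_wrap]). Hence Kr permutes
NC(kn) ([kreweras_imset]).

The same two facts show that, when the blocks of Kr(pi) stay inside residue
classes, the residues increase by one along each block of pi, cyclically, so pi
is k-divisible. Conversely, if i < j share a block of Kr(pi), then the interval
]i, j] is a union of blocks of pi, so k divides j - i if pi is k-divisible. This
proves the formula for moments.

For cumulants, group the positions into n rows of length k, one for each factor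
a. For sigma in NC(kn), the finest partition of the rows compatible with sigma
is non-crossing ([row_join_NC]), and sigma splits into pieces, one for each of
its blocks. Summing over sigma first according to this row join, and comparing
with the moment-cumulant formula for a, gives by induction on n that kappa_n(a)
is the sum of kappa_sigma over the sigma connecting all rows
([free_cumulant_products]). Finally, for k-divisible pi, the complement Kr(pi)
connects all rows exactly when pi has no block with two multiples of k,
that is, when all its blocks have k elements ([connected_card_block],
[card_block_connected]). *)

(** * Enumerating sets of ordinals *)

Local Open Scope nat_scope.

Lemma sorted_enum M (V : {set 'I_M}) : sorted ltn (map val (enum V)).
Proof.
rewrite {1}/enum_mem -enumT sorted_map; apply: sorted_filter.
  by move=> x y z; apply: ltn_trans.
by rewrite -sorted_map val_enum_ord iota_ltn_sorted.
Qed.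

Lemma nth_enum_lt M (V : {set 'I_M}) z i j :
  i < j -> j < #|V| -> nth z (enum V) i < nth z (enum V) j.
Proof.
move=> ij jV; have iV := ltn_trans ij jV; rewrite cardE in iV jV.
have := sorted_ltn_nth ltn_trans 0 (sorted_enum V) i j.
by rewrite !inE !size_map iV jV !(nth_map z) // => ->.
Qed.

Lemma nth_enum_le M (V : {set 'I_M}) z i j :
  i <= j -> j < #|V| -> nth z (enum V) i <= nth z (enum V) j.
Proof.
by rewrite leq_eqVlt => /predU1P[->//|ij jV]; exact/ltnW/nth_enum_lt.
Qed.

Lemma card_below M m : m <= M -> #|[set x : 'I_M | x < m]| = m.
Proof.
move=> le; have inj : injective (widen_ord le).
  by move=> x y /(congr1 val) /= xy; apply: val_inj.
rewrite -[RHS]card_ord -(card_imset predT inj).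
apply: eq_card => x; rewrite inE; apply/idP/imsetP => [xm|[y _ ->]] //=.
by exists (Ordinal xm) => //; apply: val_inj.
Qed.

(** * Partitions through their equivalence relation *)

Section Partitions.
Variable T : finType.
Implicit Types (P Q : {set {set T}}) (R : rel T).

Lemma pblockT P x : partition P setT -> x \in pblock P x.
Proof. by move=> partP; rewrite mem_pblock (cover_partition partP) inE. Qed.

Lemma pblockT_mem P x : partition P setT -> pblock P x \in P.
Proof. by move=> partP; rewrite pblock_mem // (cover_partition partP) inE. Qed.

Lemma same_pblockT P x y :
  partition P setT -> y \in pblock P x -> pblock P y = pblock P x.
Proof. by move=> partP; exact: same_pblock (partition_trivIset partP). Qed.

Lemma pblock_sym P x y :
  partition P setT -> (y \in pblock P x) = (x \in pblock P y).
Proof.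
by move=> partP; apply/idP/idP => /(same_pblockT partP) ->; exact: pblockT.
Qed.

Lemma partition_ext P Q : partition P setT -> partition Q setT ->
  (forall x y, (y \in pblock P x) = (y \in pblock Q x)) -> P = Q.
Proof.
move=> partP partQ eqPQ.
rewrite -(equivalence_partition_pblock partP).
rewrite -(equivalence_partition_pblock partQ).
by apply: eq_imset => x; apply/setP => y; rewrite !inE /= eqPQ.
Qed.

Lemma equivalenceT R :
  equivalence_rel R -> {in [set: T] & &, equivalence_rel R}.
Proof. by move=> eqR x y z _ _ _; apply: eqR. Qed.

Lemma eqpart_partition R :
  equivalence_rel R -> partition (equivalence_partition R setT) setT.
Proof. by move=> eqR; apply/equivalence_partitionP/equivalenceT. Qed.

Lemma mem_pblock_eqpart R x y : equivalence_rel R ->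
  (y \in pblock (equivalence_partition R setT) x) = R x y.
Proof.
by move=> eqR; rewrite (pblock_equivalence_partition (equivalenceT eqR)) ?inE.
Qed.

End Partitions.

Section NoncrossingPartitions.
Variable N : nat.
Implicit Types (P Q : {set {set 'I_N}}) (R : rel 'I_N).

Lemma noncrossingP P :
  reflect (forall V W, V \in P -> W \in P -> forall a b c d : 'I_N,
     a < b -> b < c -> c < d ->
     a \in V -> c \in V -> b \in W -> d \in W -> V = W)
  (noncrossing P).
Proof.
apply: (iffP forall_inP) => [H V W VP WP a b c d ab bc cd aV cV bW dW|H V VP].
  have /forall_inP/(_ W WP)/forallP/(_ a)/forallP/(_ b) := H V VP.
  move=> /forallP/(_ c)/forallP/(_ d); rewrite ab bc cd aV cV bW dW /=.
  by move/eqP.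
apply/forall_inP => W WP; do 4!apply/forallP => ?; apply/implyP.
by case/and5P=> ab bc cd aV /and3P[cV bW dW]; apply/eqP; exact: (H V W VP WP _ _ _ _ ab bc cd).
Qed.

Lemma NC_partition P : P \in NC N -> partition P setT.
Proof. by rewrite inE => /andP[]. Qed.

Lemma NC_cross P (a b c d : 'I_N) : P \in NC N ->
  a < b -> b < c -> c < d ->
  c \in pblock P a -> d \in pblock P b -> b \in pblock P a.
Proof.
move=> PNC ab bc cd ca db; have partP := NC_partition PNC.
have ncP : noncrossing P by move: (PNC); rewrite inE => /andP[].
move/noncrossingP in ncP.
rewrite (ncP (pblock P a) (pblock P b) _ _ a b c d) ?pblockT_mem //.
all: exact: pblockT.
Qed.

Lemma eqpart_NC R : equivalence_rel R ->
  (forall a b c d : 'I_N, a < b -> b < c -> c < d ->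
    R a c -> R b d -> R a b) ->
  equivalence_partition R setT \in NC N.
Proof.
move=> eqR ncR; set P := equivalence_partition _ _.
have partP : partition P setT by exact: eqpart_partition.
rewrite inE partP; apply/noncrossingP.
move=> V W VP WP a b c d ab bc cd aV cV bW dW.
have tP := partition_trivIset partP.
rewrite -(def_pblock tP VP aV) -(def_pblock tP WP bW).
apply/esym/(same_pblockT partP); rewrite mem_pblock_eqpart //.
apply: (ncR _ _ _ _ ab bc cd); rewrite -(mem_pblock_eqpart _ _ eqR) -/P.
  by rewrite (def_pblock tP VP aV).
by rewrite (def_pblock tP WP bW).
Qed.

End NoncrossingPartitions.

(** * The Kreweras complement as an orthogonality relation *)

Section Kreweras.
Variable N : nat.
Implicit Types (P Q : {set {set 'I_N}}) (x y i j : 'I_N).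

(** Whether the chords from x to y and from i to j cross, with position i placed
right after position x = i. Stating this as a parity, rather than as a list of
alternating orders, turns transitivity into cancellation. *)
Definition unlinked x y i j : bool :=
  ((x <= i) (+) (x <= j)) == ((y <= i) (+) (y <= j)).

Definition unlinked_from P : rel 'I_N := fun i j =>
  [forall x, forall y, (y \in pblock P x) ==> unlinked x y i j].

Definition kreweras P : {set {set 'I_N}} :=
  equivalence_partition (unlinked_from P) setT.

Lemma unlinked_fromP P i j :
  reflect (forall x y, y \in pblock P x -> unlinked x y i j)
          (unlinked_from P i j).
Proof.
apply: (iffP forallP) => [H x y|H x]; first by move: x {H}(H x) => x /forallP/(_ y)/implyP.
by apply/forallP => y; apply/implyP/H.
Qed.

Lemma unlinked_from_equivalence P : equivalence_rel (unlinked_from P).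
Proof.
move=> i j l; split.
  by apply/unlinked_fromP => x y _; rewrite /unlinked !addbb.
move=> /unlinked_fromP ij; apply/unlinked_fromP/unlinked_fromP => il x y xy;
  move: (ij x y xy) (il x y xy); rewrite /unlinked;
  by do 6!case: (_ <= _).
Qed.

Lemma mem_kreweras P i j :
  (j \in pblock (kreweras P) i) = unlinked_from P i j.
Proof. exact/mem_pblock_eqpart/unlinked_from_equivalence. Qed.

(** If ]a, c] and ]b, d] are unions of blocks of P, then so is their
difference ]a, b]. *)
Lemma kreweras_NC P : kreweras P \in NC N.
Proof.
apply: eqpart_NC; first exact: unlinked_from_equivalence.
move=> a b c d ab bc cd /unlinked_fromP ac /unlinked_fromP bd.
apply/unlinked_fromP => x y xy; move: (ac x y xy) (bd x y xy).
rewrite /unlinked; lia.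
Qed.

Lemma kreweras_unlinked P x y i j :
  y \in pblock P x -> j \in pblock (kreweras P) i -> unlinked x y i j.
Proof. by rewrite mem_kreweras => xy /unlinked_fromP/(_ x y xy). Qed.

(** A block of P that enters the gap between two consecutive elements v < v' of
another block cannot leave it, so the interval ]v, v'[ = ]v, j] is a union of
blocks. *)
Lemma kreweras_gap P (v v' j : 'I_N) : P \in NC N ->
  v < v' -> v' \in pblock P v ->
  (forall w, w \in pblock P v -> v < w -> w < v' -> False) ->
  j.+1 = v' -> j \in pblock (kreweras P) v.
Proof.
move=> PNC vv' bv' gap jv'; have partP := NC_partition PNC.
have inside x y : y \in pblock P x -> v < x -> x < v' -> v < y < v'.
  move=> xy vx xv'.
  have xNv : x \notin pblock P v by apply/negP => /gap; apply.
  have yNv : y \notin pblock P v.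
    apply: contra xNv => /(same_pblockT partP) <-.
    by rewrite pblock_sym.
  apply/andP; split; rewrite ltnNge; apply/negP => le.
    have yv : y < v.
      by rewrite ltn_neqAle le andbT; apply: contraNneq yNv => /val_inj ->; rewrite pblockT.
    have := NC_cross PNC yv vx xv'; rewrite -(pblock_sym x) // xy.
    by rewrite (pblock_sym y) // => /(_ isT bv'); apply/negP.
  have v'y : v' < y.
    by rewrite ltn_neqAle le andbT; apply: contraNneq yNv => /val_inj <-.
  by have := NC_cross PNC vx xv' v'y bv' xy; apply/negP.
rewrite mem_kreweras; apply/unlinked_fromP => x y xy.
have yx : x \in pblock P y by rewrite pblock_sym.
move: (inside x y xy) (inside y x yx); rewrite /unlinked; lia.
Qed.

(** The cyclic counterpart of [kreweras_gap]: the convex hull [u, v] of a block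
is a union of blocks, and j is the cyclic predecessor of u. *)
Lemma kreweras_wrap P (u v j : 'I_N) : P \in NC N ->
  v \in pblock P u ->
  (forall w, w \in pblock P u -> u <= w <= v) ->
  j.+1 = u \/ u = 0 :> nat /\ j.+1 = N -> j \in pblock (kreweras P) v.
Proof.
move=> PNC uv hull ju; have partP := NC_partition PNC.
have inside x y : y \in pblock P x -> u <= x <= v -> u <= y <= v.
  move=> xy /andP[ux xv].
  have [xu|xNu] := boolP (x \in pblock P u).
    by apply: hull; rewrite -(same_pblockT partP xu).
  have yNu : y \notin pblock P u.
    apply: contra xNu => /(same_pblockT partP) <-.
    by rewrite pblock_sym.
  have {}ux : u < x.
    by rewrite ltn_neqAle ux andbT; apply: contraNneq xNu => /val_inj <-; rewrite pblockT.
  have {}xv : x < v.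
    by rewrite ltn_neqAle xv andbT; apply: contraNneq xNu => /val_inj ->.
  apply/andP; split; rewrite leqNgt; apply/negP => lt.
    have := NC_cross PNC lt ux xv; rewrite -(pblock_sym x) // xy.
    by rewrite (pblock_sym y) // => /(_ isT uv); apply/negP.
  by have := NC_cross PNC ux xv lt uv xy; apply/negP.
rewrite mem_kreweras; apply/unlinked_fromP => x y xy.
have yx : x \in pblock P y by rewrite pblock_sym.
move: (inside x y xy) (inside y x yx) (hull v uv); rewrite /unlinked.
have := ltn_ord x; have := ltn_ord y.
case: ju => [|[]]; lia.
Qed.

Lemma ord_pred_ex (w : 'I_N) : 0 < w -> exists j : 'I_N, j.+1 = w.
Proof.
move=> w0; have lt : w.-1 < N by rewrite (leq_ltn_trans (leq_pred w)).
by exists (Ordinal lt); rewrite /= prednK.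
Qed.

Lemma cyclic_pred_ex (u : 'I_N) :
  exists j : 'I_N, j.+1 = u \/ u = 0 :> nat /\ j.+1 = N.
Proof.
have [u0|/ord_pred_ex[j ju]] := posnP u; last by exists j; left.
have N0 : 0 < N := leq_ltn_trans (leq0n u) (ltn_ord u).
have lt : N.-1 < N by rewrite prednK.
by exists (Ordinal lt); right; rewrite /= prednK.
Qed.

(** This recovers a non-crossing P from its complement. If x < y lie in
different blocks, take the last element v of the block of x below y. Then v and the
predecessor of the cyclically next element of that block share a block of the
complement, and exactly one of them lies in [x, y[. *)
Lemma kreweras_dual P x y : P \in NC N ->
  (forall i j, j \in pblock (kreweras P) i -> unlinked x y i j) ->
  y \in pblock P x.
Proof.
move=> PNC; have partP := NC_partition PNC.
wlog xy : x y / x <= y.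
  move=> W H; have [/W|/ltnW/W] := leqP x y; first exact.
  rewrite pblock_sym //; apply=> i j /H; by rewrite /unlinked eq_sym.
move=> H; apply/negPn/negP => nxy.
have {}xy : x < y.
  by rewrite ltn_neqAle xy andbT; apply: contraNneq nxy => /val_inj ->; rewrite pblockT.
have Px : (x \in pblock P x) && (x < y) by rewrite pblockT.
pose v := [arg max_(v > x | (v \in pblock P x) && (v < y)) (v : nat)].
have [vx vy vmax] : [/\ v \in pblock P x, v < y &
    forall w, w \in pblock P x -> w < y -> w <= v].
  rewrite /v; case: arg_maxnP => // i /andP[ix iy] imax.
  by split=> // w wx wy; apply: imax; rewrite wx.
have xv : x <= v by rewrite vmax // pblockT.
have vE := same_pblockT partP vx.
(* Either the block of x continues beyond y, or v is its last element and one
   wraps around to its first element u. *)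
case: (pickP [pred w | (w \in pblock P x) && (y < w)]) => [w0 /= w0P|noW].
  pose w := [arg min_(w < w0 | (w \in pblock P x) && (y < w)) (w : nat)].
  have [wx yw wmin] : [/\ w \in pblock P x, y < w &
      forall z, z \in pblock P x -> y < z -> w <= z].
    rewrite /w; case: arg_minnP => // i /andP[ix iy] imin.
    by split=> // z zx yz; apply: imin; rewrite zx.
  have [j jw] : exists j : 'I_N, j.+1 = w by apply: ord_pred_ex; lia.
  have gap : j \in pblock (kreweras P) v.
    apply: (kreweras_gap PNC (v' := w)) => //; first by lia.
      by rewrite vE.
    move=> z; rewrite vE => zx vz zw.
    have [zy|yz|/val_inj zy] := ltngtP z y.
    - by have := vmax z zx zy; lia.
    - by have := wmin z zx yz; lia.
    - by rewrite -zy zx in nxy.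
  by have := H _ _ gap; rewrite /unlinked; lia.
have vtop w : w \in pblock P x -> w <= v.
  move=> wx; apply: vmax => //; have := noW w; rewrite /= wx /= => /negbT.
  rewrite -leqNgt leq_eqVlt => /orP[/eqP/val_inj wy|//].
  by rewrite -wy wx in nxy.
pose u := [arg min_(u < x | u \in pblock P x) (u : nat)].
have [ux umin] : u \in pblock P x /\ forall w, w \in pblock P x -> u <= w.
  by rewrite /u; case: arg_minnP => //; rewrite pblockT.
have uE := same_pblockT partP ux.
have ux' := umin x (pblockT x partP).
have [j ju] := cyclic_pred_ex u.
have wrap : j \in pblock (kreweras P) v.
  apply: (kreweras_wrap (u := u)) => //; first by rewrite uE.
  by move=> w; rewrite uE => wx; rewrite umin // vtop.
have := H _ _ wrap; rewrite /unlinked; have := ltn_ord y; case: ju => [|[]]; lia.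
Qed.

Lemma kreweras_inj : {in NC N &, injective kreweras}.
Proof.
move=> P Q PNC QNC eqPQ; apply: partition_ext; try exact: NC_partition.
move=> x y; apply/idP/idP => xy; apply: kreweras_dual => // i j.
  by rewrite -eqPQ; apply: kreweras_unlinked.
by rewrite eqPQ; apply: kreweras_unlinked.
Qed.

Lemma kreweras_imset : kreweras @: NC N = NC N.
Proof.
apply/eqP; rewrite eqEcard card_in_imset ?leqnn ?andbT; last exact: kreweras_inj.
by apply/subsetP => _ /imsetP[P _ ->]; apply: kreweras_NC.
Qed.


End Kreweras.

Section KrewerasComplement.
Variable N : nat.
Implicit Types (P Q : {set {set 'I_N}}) (x y i j : 'I_N).

Lemma odd_place_inj : injective (@odd_place N).
Proof. by move=> x y /(congr1 val) /= ?; apply: val_inj => /=; lia. Qed.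

Lemma even_place_inj : injective (@even_place N).
Proof. by move=> x y /(congr1 val) /= ?; apply: val_inj => /=; lia. Qed.

Lemma odd_even_place x y : odd_place x <> even_place y.
Proof. by move/(congr1 val) => /=; lia. Qed.

Lemma placeP (z : 'I_(2 * N)) :
  (exists x, z = odd_place x) \/ (exists x, z = even_place x).
Proof.
have lt : z./2 < N by have := ltn_ord z; lia.
have := odd_double_half z; case: (odd z) => zE; [right|left];
  by exists (Ordinal lt); apply: val_inj => /=; lia.
Qed.

Lemma interleave_partition P Q : partition P setT -> partition Q setT ->
  partition (interleave P Q) setT.
Proof.
move=> partP partQ; apply/and3P; split.
- rewrite eqEsubset subsetT; apply/subsetP => z _; apply/bigcupP.
  case: (placeP z) => -[x ->].
    exists (@odd_place N @: pblock P x); last by rewrite imset_f // pblockT.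
    by rewrite inE imset_f // pblockT_mem.
  exists (@even_place N @: pblock Q x); last by rewrite imset_f // pblockT.
  by rewrite inE orbC imset_f // pblockT_mem.
- apply/trivIsetP => _ _ /setUP[]/imsetP[V VP ->] /setUP[]/imsetP[W WP ->] neVW;
    rewrite -setI_eq0 -subset0; apply/subsetP => _ /setIP[/imsetP[x xV ->]] /imsetP[y yW];
    try by [move/odd_even_place | move/esym/odd_even_place].
    move/odd_place_inj => exy; case/eqP: neVW; congr (_ @: _); subst y.
    have tP := partition_trivIset partP.
    by rewrite -(def_pblock tP VP xV) -(def_pblock tP WP yW).
  move/even_place_inj => exy; case/eqP: neVW; congr (_ @: _); subst y.
  have tP := partition_trivIset partQ.
  by rewrite -(def_pblock tP VP xV) -(def_pblock tP WP yW).
- apply/negP => /setUP[]/imsetP[V VP] /esym/eqP.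
    by rewrite imset_eq0; apply/negP/(partition_neq0 partP VP).
  by rewrite imset_eq0; apply/negP/(partition_neq0 partQ VP).
Qed.

Lemma linked_odd_first x y i j :
  x <= i -> i < y -> y <= j -> unlinked x y i j = false.
Proof.
rewrite /unlinked; lia.
Qed.

Lemma linked_even_first x y i j :
  i < x -> x <= j -> j < y -> unlinked x y i j = false.
Proof. rewrite /unlinked; lia. Qed.

(** The two ways in which the chord from place 2x to place 2y can cross the chord
from 2i+1 to 2j+1, when x is the smaller of x, y and i the smaller of i, j. *)
Definition alternate x y i j : bool :=
  [&& x <= i, i < y & y <= j] || [&& i < x, x <= j & j < y].

Lemma linked_alternate x y i j : ~~ unlinked x y i j ->
  [|| alternate x y i j, alternate y x i j, alternate x y j i | alternate y x j i].
Proof. rewrite /unlinked /alternate; lia. Qed.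

Lemma interleave_NC P Q : P \in NC N -> Q \in NC N ->
  (forall x y i j, y \in pblock P x -> j \in pblock Q i -> unlinked x y i j) ->
  interleave P Q \in NC (2 * N).
Proof.
move=> PNC QNC unl.
have [partP partQ] := (NC_partition PNC, NC_partition QNC).
have [tP tQ] := (partition_trivIset partP, partition_trivIset partQ).
rewrite inE interleave_partition //=; apply/noncrossingP.
have ncP : noncrossing P by move: PNC; rewrite inE => /andP[].
have ncQ : noncrossing Q by move: QNC; rewrite inE => /andP[].
move/noncrossingP in ncP; move/noncrossingP in ncQ.
move=> _ _ /setUP[]/imsetP[V VP ->] /setUP[]/imsetP[W WP ->] a b c d ab bc cd
  /imsetP[a' a'V ea] /imsetP[c' c'V ec] /imsetP[b' b'W eb] /imsetP[d' d'W ed];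
  subst a b c d; rewrite /= in ab bc cd.
- have [h1 h2 h3] : [/\ a' < b', b' < c' & c' < d'] by clear -ab bc cd; split; lia.
  by have -> : V = W by exact: (ncP V W VP WP a' b' c' d').
- have := unl a' c' b' d'; rewrite (def_pblock tP VP a'V) (def_pblock tQ WP b'W).
  by move=> /(_ c'V d'W); rewrite linked_odd_first //; clear -ab bc cd; lia.
- have := unl b' d' a' c'; rewrite (def_pblock tQ VP a'V) (def_pblock tP WP b'W).
  by move=> /(_ d'W c'V); rewrite linked_even_first //; clear -ab bc cd; lia.
- have [h1 h2 h3] : [/\ a' < b', b' < c' & c' < d'] by clear -ab bc cd; split; lia.
  by have -> : V = W by exact: (ncQ V W VP WP a' b' c' d').
Qed.

Lemma unlinked_of_interleave P Q : Q \in NC N -> partition P setT ->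
  interleave P Q \in NC (2 * N) ->
  forall x y i j, y \in pblock P x -> j \in pblock Q i -> unlinked x y i j.
Proof.
move=> QNC partP; rewrite inE => /andP[_ /noncrossingP nc].
have partQ := NC_partition QNC.
have crossing x y i j : y \in pblock P x -> j \in pblock Q i ->
    ~~ alternate x y i j.
  move=> xy ij.
  have oP : @odd_place N @: pblock P x \in interleave P Q.
    by rewrite inE imset_f // pblockT_mem.
  have eQ : @even_place N @: pblock Q i \in interleave P Q.
    by rewrite inE orbC imset_f // pblockT_mem.
  have mem : [/\ odd_place x \in @odd_place N @: pblock P x,
      odd_place y \in @odd_place N @: pblock P x,
      even_place i \in @even_place N @: pblock Q i &
      even_place j \in @even_place N @: pblock Q i].
    by split; rewrite imset_f // pblockT.
  case: mem => ox oy ei ej.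
  have ne : @odd_place N @: pblock P x <> @even_place N @: pblock Q i.
    by move=> e; move: ox; rewrite e => /imsetP[z _ /odd_even_place].
  apply/negP => /orP[]/and3P[l1 l2 l3].
    have [h1 h2 h3] : [/\ 2 * x < (2 * i).+1, (2 * i).+1 < 2 * y &
        2 * y < (2 * j).+1] by clear -l1 l2 l3; split; lia.
    by apply: ne; apply: (nc _ _ oP eQ (odd_place x) (even_place i) (odd_place y)
      (even_place j) h1 h2 h3 ox oy ei ej).
  have [h1 h2 h3] : [/\ (2 * i).+1 < 2 * x, 2 * x < (2 * j).+1 &
      (2 * j).+1 < 2 * y] by clear -l1 l2 l3; split; lia.
  by apply: ne; apply/esym/(nc _ _ eQ oP (even_place i) (odd_place x) (even_place j)
    (odd_place y) h1 h2 h3 ei ej ox oy).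
move=> x y i j xy ij.
have yx : x \in pblock P y by rewrite pblock_sym.
have ji : i \in pblock Q j by rewrite pblock_sym.
apply: contraT => /linked_alternate.
by rewrite !(negPf (crossing _ _ _ _ _ _)).
Qed.

Lemma refines_antisym P Q : partition P setT -> partition Q setT ->
  refines P Q -> refines Q P -> P = Q.
Proof.
have sub P1 P2 : partition P1 setT -> partition P2 setT -> refines P1 P2 ->
    forall x y, y \in pblock P1 x -> y \in pblock P2 x.
  move=> p1 p2 /forall_inP r x y; have /exists_inP[W WP /subsetP VW] := r _ (pblockT_mem x p1).
  move/VW; rewrite (def_pblock (partition_trivIset p2) WP) //.
  by apply: VW; rewrite pblockT.
move=> pP pQ PQ QP; apply: partition_ext => // x y.
by apply/idP/idP; exact: sub.
Qed.

Lemma Kr_kreweras P : P \in NC N -> Kr P = kreweras P.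
Proof.
move=> PNC; have partP := NC_partition PNC.
have cand : kreweras P \in Kr_candidates P.
  rewrite inE kreweras_NC interleave_NC ?kreweras_NC //.
  by move=> x y i j; exact: kreweras_unlinked.
have largest Q : Q \in Kr_candidates P -> refines Q (kreweras P).
  rewrite inE => /andP[QNC int]; have partQ := NC_partition QNC.
  apply/forall_inP => W WQ; have /set0Pn[i iW] := partition_neq0 partQ WQ.
  apply/exists_inP; exists (pblock (kreweras P) i).
    exact: pblockT_mem (NC_partition (kreweras_NC P)).
  apply/subsetP => j jW; rewrite mem_kreweras; apply/unlinked_fromP => x y xy.
  apply: (unlinked_of_interleave QNC partP int) => //.
  by rewrite (def_pblock (partition_trivIset partQ) WQ iW).
rewrite /Kr; case: pickP => [Q /andP[Qc /forall_inP max]|/(_ (kreweras P))].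
  move: (Qc); rewrite inE => /andP[QNC _].
  apply: refines_antisym; rewrite ?largest ?max ?NC_partition ?kreweras_NC //.
by rewrite cand /= => /negP[]; apply/forall_inP.
Qed.

End KrewerasComplement.

(** * Divisible partitions and residues *)

Section Divisibility.
Variables k n : nat.
Notation N := (k * n).
Implicit Types (P Q : {set {set 'I_N}}) (V : {set 'I_N}).

Definition constant_mod P :=
  [forall i, forall j, (j \in pblock P i) ==> (i == j %[mod k])].

Lemma constant_modP P :
  reflect (forall i j, j \in pblock P i -> i = j %[mod k]) (constant_mod P).
Proof.
apply: (iffP forallP) => [H i j|H i].
  by have /forallP/(_ j)/implyP/[apply]/eqP := H i.
by apply/forallP => j; apply/implyP => /H/eqP.
Qed.

Lemma block_nth_enum P V z i : partition P setT -> V \in P ->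
  i < #|V| -> pblock P (nth z (enum V) i) = V.
Proof.
move=> partP VP iV; apply: (def_pblock (partition_trivIset partP)) => //.
by rewrite -mem_enum mem_nth -?cardE.
Qed.

(** If v' follows v in a block of P, then v' - 1 and v share a block of the
complement, whence v' = v + 1 modulo k. *)
Lemma block_residues P V z i : P \in NC N -> constant_mod (kreweras P) ->
  V \in P -> i < #|V| -> nth z (enum V) i = nth z (enum V) 0 + i %[mod k].
Proof.
move=> PNC /constant_modP cm VP; have partP := NC_partition PNC.
elim: i => [|i IH] iV; first by rewrite addn0.
have iV' := ltnW iV.
set v := nth _ _ i.+1; set w := nth z (enum V) i in IH.
have wv : w < v by apply: nth_enum_lt.
have [j jv] : exists j : 'I_N, j.+1 = v by apply: ord_pred_ex; lia.
have /cm : j \in pblock (kreweras P) w.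
  apply: (kreweras_gap PNC wv) => //.
    by rewrite block_nth_enum // -mem_enum mem_nth -?cardE.
  rewrite block_nth_enum // => u; rewrite -mem_enum => uV wu uv.
  have lt : index u (enum V) < #|V| by rewrite cardE index_mem.
  have uE : u = nth z (enum V) (index u (enum V)) by rewrite nth_index.
  have [le|le] := leqP (index u (enum V)) i.
    have [e|ne] := eqVneq (index u (enum V)) i.
      by move: wu; rewrite uE e ltnn.
    have := @nth_enum_lt _ V z (index u (enum V)) i; rewrite -uE -/w; lia.
  have [e|ne] := eqVneq (index u (enum V)) i.+1.
    by move: uv; rewrite uE e ltnn.
  have := @nth_enum_lt _ V z i.+1 (index u (enum V)); rewrite -uE -/v; lia.
by move=> wj; rewrite -jv -(addn1 j) -modnDml -wj IH // modnDml -addnA addn1.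
Qed.

(** By [block_residues] the last element of the block is congruent to
min V + #|V| - 1, and closing the block up cyclically shows that it is also
congruent to min V - 1. *)
Lemma constant_mod_divisible P V : P \in NC N ->
  constant_mod (kreweras P) -> V \in P -> k %| #|V|.
Proof.
move=> PNC cm VP; have partP := NC_partition PNC.
have /set0Pn[z zV] := partition_neq0 partP VP.
have V0 : 0 < #|V| by apply/card_gt0P; exists z.
set u := nth z (enum V) 0; set v := nth z (enum V) #|V|.-1.
have V1 : #|V|.-1 < #|V| by lia.
have res := block_residues z PNC cm VP V1.
have [j ju] := cyclic_pred_ex u.
have /(constant_modP _ cm) vj : j \in pblock (kreweras P) v.
  apply: (kreweras_wrap PNC (u := u)) => //.
    by rewrite block_nth_enum // -mem_enum mem_nth -?cardE.
  rewrite block_nth_enum // => w; rewrite -mem_enum => wV.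
  have lt : index w (enum V) < #|V| by rewrite cardE index_mem.
  have wE : w = nth z (enum V) (index w (enum V)) by rewrite nth_index.
  by rewrite wE !nth_enum_le // -ltnS prednK.
have e : u + #|V| = u + 0 %[mod k].
  have -> : u + #|V| = (u + #|V|.-1) + 1 by lia.
  rewrite -modnDml -res -/v vj modnDml addn1 addn0.
  case: ju => [-> //|[-> ->]]; by rewrite modnMr mod0n.
by move/eqP: e; rewrite eqn_modDl mod0n.
Qed.

Lemma card_saturated P (S : {set 'I_N}) : partition P setT ->
  (forall V, V \in P -> k %| #|V|) ->
  (forall x y, y \in pblock P x -> x \in S -> y \in S) -> k %| #|S|.
Proof.
move=> partP div sat; have tP := partition_trivIset partP.
have -> : S = cover (P ::&: S).
  apply/setP => x; apply/idP/bigcupP => [xS|[V]].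
    exists (pblock P x); last by rewrite pblockT.
    by rewrite inE pblockT_mem //=; apply/subsetP => y /sat; apply.
  by rewrite inE => /andP[_ /subsetP]; apply.
have /eqP <- : trivIset (P ::&: S) by apply: trivIsetI.
by apply: dvdn_sum => V; rewrite inE => /andP[/div].
Qed.

(** If i < j share a block of the complement, then ]i, j] is a union of
blocks of P and has j - i elements. *)
Lemma divisible_constant_mod P : P \in NC N ->
  (forall V, V \in P -> k %| #|V|) -> constant_mod (kreweras P).
Proof.
move=> PNC div; have partP := NC_partition PNC.
apply/constant_modP => i j; wlog ij : i j / i <= j.
  move=> W; have [/W|/ltnW/W H] := leqP i j; first exact.
  by rewrite pblock_sym ?(NC_partition (kreweras_NC P)) // => /H.
move=> Kij; pose S := [set x : 'I_N | i < x <= j].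
have kS : k %| #|S|.
  apply: (card_saturated partP div) => x y xy; rewrite !inE.
  by have := kreweras_unlinked xy Kij; rewrite /unlinked; lia.
have cS : #|S| = j - i.
  have -> : S = [set x : 'I_N | x < j.+1] :\: [set x : 'I_N | x < i.+1].
    by apply/setP => x; rewrite !inE !ltnS -ltnNge.
  rewrite cardsD (setIidPr _) ?card_below //.
  by apply/subsetP => x; rewrite !inE !ltnS => /leq_trans; apply.
by apply/eqP; rewrite eq_sym eqn_mod_dvd // -cS.
Qed.

End Divisibility.

(** * Joining with the partition into rows *)

Section Rows.
Variables k n : nat.
Notation N := (k * n).
Implicit Types (Q : {set {set 'I_N}}) (U V W : {set 'I_n}) (x y : 'I_N).

Lemma row_subproof x : x %/ k < n.
Proof.
case: x => x /= lt; case: (posnP k) => [k0|k0]; first by rewrite k0 in lt.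
by rewrite ltn_divLR // mulnC.
Qed.

Definition row_of x : 'I_n := Ordinal (row_subproof x).

Definition thicken U : {set 'I_N} := [set x | row_of x \in U].

Definition saturated Q (S : {set 'I_N}) : bool :=
  [forall B in Q, forall x in B, forall y in B, (x \in S) ==> (y \in S)].

Definition row_connected V Q : bool :=
  [forall U : {set 'I_n}, (U \subset V) && saturated Q (thicken U) ==>
     (U == set0) || (U == V)].

Definition row_NC V : {set {set {set 'I_N}}} :=
  [set Q | [&& partition Q (thicken V), noncrossing Q & row_connected V Q]].

(** A union of rows that is saturated for Q cannot separate two rows linked by Q.
Quantifying over all such unions, rather than over paths, makes this an
equivalence at once; its classes are the blocks of the join of Q with the
partition into rows. *)
Definition row_linked Q : rel 'I_n := fun u v =>
  [forall U, saturated Q (thicken U) ==> ((u \in U) == (v \in U))].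

Definition row_join Q : {set {set 'I_n}} :=
  equivalence_partition (row_linked Q) setT.

Lemma saturatedP Q (S : {set 'I_N}) :
  reflect (forall B x y, B \in Q -> x \in B -> y \in B -> x \in S -> y \in S)
          (saturated Q S).
Proof.
apply: (iffP forall_inP) => [H B x y BQ xB yB|H B BQ].
  by have /forall_inP/(_ x xB)/forall_inP/(_ y yB)/implyP := H B BQ.
apply/forall_inP => x xB; apply/forall_inP => y yB; apply/implyP.
exact: H BQ xB yB.
Qed.

Lemma saturated_pblockP Q (S : {set 'I_N}) : partition Q setT ->
  reflect (forall x y, y \in pblock Q x -> x \in S -> y \in S) (saturated Q S).
Proof.
move=> partQ; apply: (iffP (saturatedP _ _)) => [H x y|H B x y BQ xB yB].
  by apply: H; rewrite ?pblockT_mem ?pblockT.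
by apply: H; rewrite (def_pblock (partition_trivIset partQ) BQ xB).
Qed.

Lemma row_connectedP V Q :
  reflect (forall U, U \subset V -> saturated Q (thicken U) -> U = set0 \/ U = V)
          (row_connected V Q).
Proof.
apply: (iffP forallP) => [H U UV US|H U].
  by have := H U; rewrite UV US => /orP[]/eqP; [left|right].
apply/implyP => /andP[UV US]; apply/orP.
by case: (H U UV US) => ->; [left|right].
Qed.

Lemma row_linkedP Q u v :
  reflect (forall U, saturated Q (thicken U) -> (u \in U) = (v \in U))
          (row_linked Q u v).
Proof.
apply: (iffP forallP) => [H U US|H U]; first by have := H U; rewrite US => /eqP.
by apply/implyP => /H ->.
Qed.

Lemma row_linked_equivalence Q : equivalence_rel (row_linked Q).
Proof.
move=> u v w; split; first exact/row_linkedP.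
move=> /row_linkedP uv; apply/row_linkedP/row_linkedP => H U US.
  by rewrite -uv // H.
by rewrite uv // H.
Qed.

Lemma row_linked_sym Q u v : row_linked Q u v = row_linked Q v u.
Proof.
by apply/row_linkedP/row_linkedP => H U /H ->.
Qed.

Lemma row_linked_trans Q u v w :
  row_linked Q u v -> row_linked Q u w = row_linked Q v w.
Proof. by case: (row_linked_equivalence Q u v w) => _; apply. Qed.

Lemma mem_row_join Q u v : (v \in pblock (row_join Q) u) = row_linked Q u v.
Proof. exact/mem_pblock_eqpart/row_linked_equivalence. Qed.

Lemma row_join_partition Q : partition (row_join Q) setT.
Proof. exact/eqpart_partition/row_linked_equivalence. Qed.

Lemma row_linked_block Q x y : partition Q setT ->
  y \in pblock Q x -> row_linked Q (row_of x) (row_of y).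
Proof.
move=> partQ xy; apply/row_linkedP => U /(saturated_pblockP _ partQ) US.
have yx : x \in pblock Q y by rewrite pblock_sym.
by apply/idP/idP => H; [have := US x y xy | have := US y x yx]; rewrite !inE; apply.
Qed.

Lemma row_leq x y : x <= y -> row_of x <= row_of y.
Proof. exact: leq_div2r. Qed.

Lemma row_ltn x y : row_of x < row_of y -> x < y.
Proof. by rewrite !ltnNge; apply: contra; exact: row_leq. Qed.

(** A pair x, y in one block of Q shields the rows lying strictly between
them: leaving this zone from a row linked to a means crossing the chord x, y, which
would link a to x. *)
Lemma saturated_linked_between Q a x y : Q \in NC N -> y \in pblock Q x ->
  ~~ row_linked Q a (row_of x) ->
  saturated Q (thicken [set w | row_linked Q a w & row_of x < w < row_of y]).
Proof.
move=> QNC xy nax; have partQ := NC_partition QNC.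
have linkxy := row_linked_block partQ xy.
have nay : ~~ row_linked Q a (row_of y).
  apply: contra nax => ay.
  by rewrite (row_linked_trans _ ay) row_linked_sym.
apply/(saturated_pblockP _ partQ) => x' y' x'y'.
have link := row_linked_block partQ x'y'.
rewrite !inE => /andP[ax' /andP[xx' x'y]].
have ay' : row_linked Q a (row_of y') by rewrite row_linked_sym -(row_linked_trans _ link) row_linked_sym.
have notx : x' \in pblock Q x = false.
  apply/negbTE; apply: contra nax => /(row_linked_block partQ) xx.
  by rewrite row_linked_sym (row_linked_trans _ xx) row_linked_sym.
rewrite ay' andTb; apply/andP; split; rewrite ltnNge leq_eqVlt; apply/negP => /predU1P[/val_inj e|lt].
- by rewrite -e ay' in nax.
- have := NC_cross QNC (row_ltn lt) (row_ltn xx') (row_ltn x'y).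
  rewrite pblock_sym // x'y' => /(_ isT xy) e.
  by rewrite (same_pblockT partQ e) pblock_sym // x'y' in notx.
- by rewrite e ay' in nay.
- by have := NC_cross QNC (row_ltn xx') (row_ltn x'y) (row_ltn lt) xy x'y'; rewrite notx.
Qed.

(** Suppose a < b < c < d with a linked to c, b to d, but not to a. The rows
strictly between a and c not linked to a form a saturated union: a block leading out
of it would, by [saturated_linked_between], split the class of a and separate a from
c. That union contains b and not d. *)
Lemma row_join_NC Q : Q \in NC N -> row_join Q \in NC n.
Proof.
move=> QNC; have partQ := NC_partition QNC.
apply: eqpart_NC; first exact: row_linked_equivalence.
move=> a b c d ab bc cd ac bd; apply: contraT => nab.
have aa : row_linked Q a a by apply/row_linkedP.
pose W := [set w : 'I_n | (a < w < c) && ~~ row_linked Q a w].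
suff /(row_linkedP _ _ _ bd) : saturated Q (thicken W).
  by rewrite !inE ab bc nab /= [d < c]ltnNge (ltnW cd) andbF.
apply/(saturated_pblockP _ partQ) => x y xy.
rewrite !inE => /andP[/andP[ax xc] nax].
have linkxy := row_linked_block partQ xy.
have nay : ~~ row_linked Q a (row_of y).
  apply: contra nax => ay.
  by rewrite (row_linked_trans _ ay) row_linked_sym.
have yx : x \in pblock Q y by rewrite pblock_sym.
have /esym := row_linkedP _ _ _ ac _ (saturated_linked_between QNC xy nax).
have := row_linkedP _ _ _ ac _ (saturated_linked_between QNC yx nay).
rewrite !inE aa ac nay andbT [row_of x < a]ltnNge (ltnW ax) xc ax !andTb.
rewrite [c < row_of x]ltnNge (ltnW xc) andbF !andbT => ya yc.
rewrite !ltn_neqAle [a <= _]leqNgt [_ <= c]leqNgt ya yc !andbT.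
apply/andP; split; apply: contraNneq nay => /val_inj e; first by rewrite -e.
by rewrite e.
Qed.

Lemma row_join_saturated Q V : partition Q setT ->
  V \in row_join Q -> saturated Q (thicken V).
Proof.
move=> partQ VJ; apply/(saturated_pblockP _ partQ) => x y xy.
have tJ := partition_trivIset (row_join_partition Q).
rewrite !inE => xV; rewrite -(def_pblock tJ VJ xV) mem_row_join.
exact: row_linked_block.
Qed.

Lemma row_join_connected Q V : V \in row_join Q -> row_connected V Q.
Proof.
move=> VJ; apply/row_connectedP => U /subsetP UV US.
have tJ := partition_trivIset (row_join_partition Q).
have [->|/set0Pn[u uU]] := eqVneq U set0; [by left | right].
apply/eqP; rewrite eqEsubset; apply/andP; split; first exact/subsetP.
apply/subsetP => v; rewrite -(def_pblock tJ VJ (UV u uU)) mem_row_join.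
by move=> /row_linkedP/(_ U US) <-.
Qed.

Lemma row_join_unique Q (P : {set {set 'I_n}}) :
  partition Q setT -> partition P setT ->
  (forall V, V \in P -> saturated Q (thicken V) /\ row_connected V Q) ->
  row_join Q = P.
Proof.
move=> partQ partP H; apply: partition_ext => //; first exact: row_join_partition.
have sat V : V \in P -> saturated Q (thicken V) by case/H.
move=> u v; rewrite mem_row_join; apply/row_linkedP/idP => [uv|uv U US].
  by rewrite -(uv _ (sat _ (pblockT_mem u partP))) pblockT.
have VP := pblockT_mem u partP; set V := pblock P u in VP uv.
have [_ /row_connectedP conn] := H V VP.
have UVS : saturated Q (thicken (U :&: V)).
  apply/saturatedP => B x y BQ xB yB; move/saturatedP in US; move/saturatedP: (sat _ VP).
  move=> /(_ B x y BQ xB yB); move: (US B x y BQ xB yB); rewrite !inE.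
  by move=> h1 h2 /andP[/h1-> /h2->].
have uV : u \in V by rewrite pblockT.
case: (conn _ (subsetIr U V) UVS) => /setP e; have := e u; have := e v;
  by rewrite !inE uv uV !andbT => -> ->.
Qed.

End Rows.

(** * Equal blocks and connected complements *)

Section ConnectedKreweras.
Variables k n : nat.
Notation N := (k * n).
Hypothesis k_gt0 : 0 < k.
Implicit Types (P Q : {set {set 'I_N}}) (V : {set 'I_N}).

Lemma thickenT : thicken k [set: 'I_n] = setT.
Proof. by apply/setP => x; rewrite !inE. Qed.

Lemma row_start_subproof (p : 'I_n) : k * p < N.
Proof. by rewrite ltn_pmul2l. Qed.

Definition row_start (p : 'I_n) : 'I_N := Ordinal (row_start_subproof p).

Lemma row_start_leq p (i : 'I_N) : (row_start p <= i) = (p <= row_of i).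
Proof. by rewrite /= leq_divRL // mulnC. Qed.

Lemma row_of_start p : row_of (row_start p) = p.
Proof. by apply: val_inj; rewrite /= mulKn. Qed.

Lemma unlinked_row_start p q i j :
  unlinked (row_start p) (row_start q) i j = unlinked p q (row_of i) (row_of j).
Proof. by rewrite /unlinked !row_start_leq. Qed.

Lemma row_startK (x : 'I_N) : k %| x -> x = row_start (row_of x).
Proof. by move=> kx; apply: val_inj; rewrite /= [RHS]mulnC divnK. Qed.

(** A block of P with at least 2k elements contains two multiples kp < kq
of k, because residues increase by one along it. Then no block of the complement
leaves the rows p, ..., q - 1, so the complement does not connect all rows. *)
Lemma connected_card_block P V : P \in NC N -> constant_mod (kreweras P) ->
  row_connected setT (kreweras P) -> V \in P -> #|V| = k.
Proof.
move=> PNC cm /row_connectedP conn VP; have partP := NC_partition PNC.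
have /set0Pn[z zV] := partition_neq0 partP VP.
have V0 : 0 < #|V| by apply/card_gt0P; exists z.
have /dvdnP[m mV] := constant_mod_divisible PNC cm VP.
have m0 : 0 < m by move: V0; rewrite mV muln_gt0 => /andP[].
have [m1|m_gt1] := leqP m 1; first by rewrite mV (_ : m = 1) ?mul1n //; lia.
have le2k : 2 * k <= #|V| by rewrite mV leq_mul2r m_gt1 orbT.
have res := block_residues z PNC cm VP.
(* As v 0 + i0 = k * v 0 modulo k, the element of rank i0 is a multiple of k. *)
pose v i := nth z (enum V) i; pose i0 := (k.-1 * v 0) %% k.
have i0k : i0 < k by rewrite ltn_mod.
have mult i : i = i0 %[mod k] -> i < #|V| -> k %| v i.
  move=> ii0 iV; rewrite /dvdn res // -modnDmr ii0 modnDmr modnDmr.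
  by rewrite -mulSn prednK // modnMr.
have lt1 : i0 + k < #|V| by lia.
have kx := mult i0 erefl (leq_ltn_trans (leq_addr _ _) lt1).
have ky := mult (i0 + k) (modnDr _ _) lt1.
have xy : v i0 < v (i0 + k) by apply: nth_enum_lt => //; lia.
move: kx ky xy => /row_startK; set p := row_of _ => xE.
move=> /row_startK; set q := row_of _ => yE; rewrite xE yE => xy.
have pq : p < q by move: xy; rewrite /= ltn_pmul2l.
have link : row_start q \in pblock P (row_start p).
  rewrite -xE -yE block_nth_enum //; last by lia.
  by rewrite -mem_enum mem_nth -?cardE.
pose U := [set w : 'I_n | p <= w < q].
have partK := NC_partition (kreweras_NC P).
have US : saturated (kreweras P) (thicken k U).
  apply/(saturated_pblockP _ partK) => i j ij; rewrite !inE.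
  have := kreweras_unlinked link ij; rewrite unlinked_row_start /unlinked.
  clear -pq; lia.
case: (conn U (subsetT _) US) => /setP e.
  by have := e p; rewrite !inE leqnn pq.
by have := e q; rewrite !inE ltnn andbF.
Qed.

(** The row join of the complement is itself the complement of some P0
in NC(n). If p and q share a block of P0, then kp and kq share a block of P, by
[kreweras_dual]; as a block with k elements contains a single multiple of k, p = q.
So P0 is discrete and its complement has one block. *)
Lemma card_block_connected P : P \in NC N -> constant_mod (kreweras P) ->
  (forall V, V \in P -> #|V| = k) -> row_connected setT (kreweras P).
Proof.
move=> PNC cm cardk; have partP := NC_partition PNC.
have partK := NC_partition (kreweras_NC P).
suff linked u w : row_linked (kreweras P) u w.
  apply/row_connectedP => U _ US.
  have [->|/set0Pn[u uU]] := eqVneq U set0; [by left | right].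
  by apply/setP => w; rewrite -(row_linkedP _ _ _ (linked u w) U US) uU inE.
have : row_join (kreweras P) \in NC n by apply/row_join_NC/kreweras_NC.
rewrite -{1}kreweras_imset => /imsetP[P0 P0NC joinE].
rewrite -mem_row_join joinE mem_kreweras; apply/unlinked_fromP => p q pq.
suff -> : q = p by rewrite /unlinked.
have xy : row_start q \in pblock P (row_start p).
  apply: kreweras_dual => // i j ij; rewrite unlinked_row_start.
  apply: (kreweras_unlinked pq); rewrite -joinE mem_row_join.
  exact: row_linked_block.
have xx := pblockT (row_start p) partP.
have VP := pblockT_mem (row_start p) partP.
set V := pblock _ _ in xy xx VP; have res := block_residues (row_start p) PNC cm VP.
have idx x : x \in V -> index x (enum V) < k.
  by move=> xV; rewrite -[ltnRHS](cardk V VP) cardE index_mem mem_enum.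
have rx := res _ (leq_trans (idx _ xx) (eq_leq (esym (cardk V VP)))).
have ry := res _ (leq_trans (idx _ xy) (eq_leq (esym (cardk V VP)))).
rewrite !nth_index ?mem_enum // in rx ry.
have : nth (row_start p) (enum V) 0 + index (row_start q) (enum V) ==
  nth (row_start p) (enum V) 0 + index (row_start p) (enum V) %[mod k].
  by rewrite -rx -ry /= !modnMr.
rewrite eqn_modDl !modn_small ?idx // => /eqP e.
apply/esym; rewrite -(row_of_start p) -(row_of_start q); congr row_of.
by rewrite -[LHS](nth_index (row_start p) (s := enum V)) ?mem_enum // -e nth_index ?mem_enum.
Qed.

End ConnectedKreweras.

(** * Splitting a partition along its row join *)

Local Open Scope ring_scope.

Section Distribution.
Variables (C : comNzRingType) (k n : nat).
Notation N := (k * n)%N.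
Implicit Types (Q : {set {set 'I_N}}) (P : {set {set 'I_n}}) (V : {set 'I_n}).

Lemma glue_partition (g : {set 'I_n} -> {set {set 'I_N}}) P :
  partition P setT -> (forall V, V \in P -> partition (g V) (thicken k V)) ->
  partition (\bigcup_(V in P) g V) setT.
Proof.
move=> partP gP; have tP := partition_trivIset partP.
apply/and3P; split.
- rewrite eqEsubset subsetT; apply/subsetP => x _.
  have VP := pblockT_mem (row_of x) partP.
  have : x \in cover (g (pblock P (row_of x))).
    by rewrite (cover_partition (gP _ VP)) inE pblockT.
  by case/bigcupP => B BV xB; apply/bigcupP; exists B => //; apply/bigcupP; exists (pblock P (row_of x)).
- apply/trivIsetP => B B' /bigcupP[V VP BV] /bigcupP[V' VP' BV'].
  apply: contraR; rewrite -setI_eq0 => /set0Pn[x /setIP[xB xB']].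
  have /subsetP/(_ x xB) := partitionS (gP _ VP) BV.
  have /subsetP/(_ x xB') := partitionS (gP _ VP') BV'.
  rewrite !inE => xV' xV.
  have e : V = V' by rewrite -(def_pblock tP VP xV) -(def_pblock tP VP' xV').
  subst V'; have tg := partition_trivIset (gP _ VP).
  by rewrite -(def_pblock tg BV xB) -(def_pblock tg BV' xB').
- by apply/negP => /bigcupP[V VP]; rewrite (partition0 (gP _ VP)).
Qed.

(** Blocks inside one piece do not cross by hypothesis; two crossing blocks from
different pieces would make their rows cross in P. *)
Lemma glue_noncrossing (g : {set 'I_n} -> {set {set 'I_N}}) P :
  P \in NC n ->
  (forall V, V \in P -> partition (g V) (thicken k V) /\ noncrossing (g V)) ->
  noncrossing (\bigcup_(V in P) g V).
Proof.
move=> PNC gP; have partP := NC_partition PNC.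
have tP := partition_trivIset partP.
apply/noncrossingP => B B' /bigcupP[V VP BV] /bigcupP[V' VP' BV'] a b c d
  ab bc cd aB cB bB' dB'.
have [partV /noncrossingP ncV] := gP V VP; have [partV' _] := gP V' VP'.
have /subsetP rowB := partitionS partV BV.
have /subsetP rowB' := partitionS partV' BV'.
have := rowB a aB; have := rowB c cB; rewrite !inE => cV aV.
have := rowB' b bB'; have := rowB' d dB'; rewrite !inE => dV' bV'.
have [e|ne] := eqVneq V V'; first by subst V'; apply: (ncV B B' BV BV' a b c d).
have notin (x y : 'I_N) : row_of x \in V -> row_of y \in V' -> row_of x != row_of y.
  move=> xV yV'; apply: contraNneq ne => e.
  by rewrite -(def_pblock tP VP xV) e (def_pblock tP VP' yV').
have lt (x y : 'I_N) : (x < y)%N -> row_of x != row_of y -> (row_of x < row_of y)%N.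
  by move=> xy nxy; rewrite ltn_neqAle row_leq ?(ltnW xy) // andbT; exact: nxy.
have := NC_cross PNC (lt _ _ ab (notin _ _ aV bV')).
have cb : row_of b != row_of c by rewrite eq_sym notin.
move=> /(_ _ _ (lt _ _ bc cb) (lt _ _ cd (notin _ _ cV dV'))).
rewrite (def_pblock tP VP aV) cV (def_pblock tP VP' bV') dV' => /(_ isT isT) bV.
by have := notin b b bV bV'; rewrite eqxx.
Qed.

Lemma restrict_partition Q V : partition Q setT ->
  saturated Q (thicken k V) ->
  partition (Q ::&: thicken k V) (thicken k V).
Proof.
move=> partQ /(saturated_pblockP _ partQ) sat; apply/and3P; split.
- rewrite eqEsubset; apply/andP; split; apply/subsetP => x.
    by case/bigcupP => B; rewrite inE => /andP[_ /subsetP]; apply.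
  move=> xV; apply/bigcupP; exists (pblock Q x); last by rewrite pblockT.
  by rewrite inE pblockT_mem //=; apply/subsetP => y xy; apply: sat xV.
- exact: trivIsetI (partition_trivIset partQ).
- by apply/negP; rewrite inE (partition0 partQ).
Qed.

Lemma restrict_glue (g : {set 'I_n} -> {set {set 'I_N}}) P V :
  partition P setT -> (forall V, V \in P -> partition (g V) (thicken k V)) ->
  V \in P -> (\bigcup_(V in P) g V) ::&: thicken k V = g V.
Proof.
move=> partP gP VP; have tP := partition_trivIset partP.
apply/setP => B; rewrite inE; apply/andP/idP => [[/bigcupP[V' VP' BV'] BV]|BV].
  have /set0Pn[x xB] := partition_neq0 (gP _ VP') BV'.
  have := subsetP (partitionS (gP _ VP') BV') x xB.
  have := subsetP BV x xB; rewrite !inE => xV xV'.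
  by rewrite -(def_pblock tP VP xV) (def_pblock tP VP' xV').
by split; [apply/bigcupP; exists V | apply: partitionS (gP _ VP) BV].
Qed.

Lemma restrict_connected Q V :
  saturated Q (thicken k V) ->
  row_connected V (Q ::&: thicken k V) = row_connected V Q.
Proof.
move=> /saturatedP satV.
have E (U : {set 'I_n}) : U \subset V ->
    saturated (Q ::&: thicken k V) (thicken k U) = saturated Q (thicken k U).
  move=> /subsetP UV; apply/saturatedP/saturatedP => H B x y; last first.
    by rewrite inE => /andP[BQ _]; apply: H.
  move=> BQ xB yB xU; apply: (H B x y) => //; rewrite inE BQ /=.
  apply/subsetP => z zB; apply: (satV B x z) => //; move: xU; rewrite !inE; exact: UV.
by apply/row_connectedP/row_connectedP => H U UV US; apply: H; rewrite ?E // -E.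
Qed.

(** A partition with row join P amounts to an independent choice, for each
block V of P, of a non-crossing partition of the positions in the rows V that
connects these rows; the inverse bijection restricts to each V. *)
Lemma sum_row_join (P : {set {set 'I_n}}) (F : {set 'I_N} -> C) : P \in NC n ->
  \sum_(Q in NC N | row_join Q == P) \prod_(B in Q) F B =
  \prod_(V in P) \sum_(Q in row_NC k V) \prod_(B in Q) F B.
Proof.
move=> PNC; have partP := NC_partition PNC.
rewrite (big_distr_big_dep set0).
pose glue (g : {ffun {set 'I_n} -> {set {set 'I_N}}}) := \bigcup_(V in P) g V.
pose restr Q := [ffun V => if V \in P then Q ::&: thicken k V else set0].
have restrK Q : Q \in NC N -> row_join Q == P -> glue (restr Q) = Q.
  move=> QNC /eqP JP; have partQ := NC_partition QNC.
  apply/setP => B; apply/bigcupP/idP => [[V VP]|BQ].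
    by rewrite ffunE VP inE => /andP[].
  have /set0Pn[x xB] := partition_neq0 partQ BQ.
  have VP := pblockT_mem (row_of x) partP; exists (pblock P (row_of x)) => //.
  rewrite ffunE VP inE BQ; apply/subsetP => y yB.
  rewrite inE -JP mem_row_join row_linked_block //.
  by rewrite (def_pblock (partition_trivIset partQ) BQ xB).
rewrite (reindex_onto glue restr); last by move=> Q /andP[]; exact: restrK.
have famP g : (g \in pfamily set0 (mem P) (fun V => mem (row_NC k V))) =
    (glue g \in NC N) && (row_join (glue g) == P) && (restr (glue g) == g).
  apply/pfamilyP/andP => [[/supportP g0 gV]|[/andP[GNC /eqP JP] /eqP rE]].
    have gV' V : V \in P -> [/\ partition (g V) (thicken k V), noncrossing (g V) &
        row_connected V (g V)].
      by move=> VP; have := gV V VP; rewrite !inE => /and3P.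
    have gp V : V \in P -> partition (g V) (thicken k V) by case/gV'.
    have partG : partition (glue g) setT by exact: glue_partition.
    have GNC : glue g \in NC N.
      rewrite inE partG; apply: glue_noncrossing => // V /gV'[]; split=> //.
    have satG V : V \in P -> saturated (glue g) (thicken k V).
      move=> VP; apply/saturatedP => B x y /bigcupP[V' VP' BV'] xB yB.
      have /subsetP sub := partitionS (gp _ VP') BV'.
      have := sub x xB; have := sub y yB; rewrite !inE => yV' xV' xV.
      have tP := partition_trivIset partP.
      by rewrite -(def_pblock tP VP xV) (def_pblock tP VP' xV').
    split; last first.
      apply/eqP/ffunP => V; rewrite ffunE; case: ifP => VP.
        exact: restrict_glue.
      by rewrite g0 // VP.
    rewrite GNC; apply/eqP/row_join_unique => // V VP; split; first exact: satG.
    by rewrite -restrict_connected ?satG // restrict_glue //; case: (gV' V VP).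
  have partG := NC_partition GNC.
  split.
    by apply/supportP => V VP; rewrite -rE ffunE (negPf VP).
  move=> V VP; rewrite -rE ffunE; have -> : V \in P by exact: VP.
  have VJ : V \in row_join (glue g) by rewrite JP.
  have sat := row_join_saturated partG VJ.
  rewrite !inE restrict_partition //= restrict_connected // row_join_connected // andbT.
  have ncG : noncrossing (glue g) by move: GNC; rewrite inE => /andP[].
  apply/noncrossingP => B B'; rewrite !inE => /andP[BG _] /andP[BG' _].
  by move/noncrossingP: ncG; apply.
apply: eq_big => [g|g]; first by rewrite famP.
rewrite -famP => /pfamilyP[_ gV].
have gp V : V \in P -> partition (g V) (thicken k V).
  by move=> VP; have := gV V VP; rewrite !inE => /and3P[].
pose h V := if V \in P then g V else set0.
have -> : glue g = \bigcup_V h V by rewrite /glue big_mkcond.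
rewrite partition_disjoint_bigcup => [|V V' ne].
  rewrite [RHS]big_mkcond; apply: eq_bigr => V _; rewrite /h.
  by case: ifP => // _; rewrite big_set0.
rewrite /h -setI_eq0 -subset0; apply/subsetP => B.
case: ifP => VP; last by rewrite inE => /andP[]; rewrite inE.
case: ifP => VP'; last by rewrite inE => /andP[]; rewrite !inE.
move=> /setIP[BV BV']; have [x xB] := set0Pn _ (partition_neq0 (gp _ VP) BV).
have := subsetP (partitionS (gp _ VP') BV') x xB.
have := subsetP (partitionS (gp _ VP) BV) x xB.
have tP := partition_trivIset partP; rewrite !inE => xV xV'.
by case/eqP: ne; rewrite -(def_pblock tP VP xV) (def_pblock tP VP' xV').
Qed.


End Distribution.

(** * Transport along increasing maps *)

Section Transport.
Variables (M N : nat) (f : 'I_M -> 'I_N).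
Hypothesis f_incr : {homo f : x y / (x < y)%N}.
Implicit Types (P : {set {set 'I_M}}) (B : {set 'I_M}).

Definition push P : {set {set 'I_N}} := [set f @: (B : {set 'I_M}) | B in P].

Lemma incr_mono : {mono f : x y / (x < y)%N}.
Proof.
move=> x y; have [xy|yx|/val_inj->] := ltngtP x y; last by rewrite ltnn.
  exact: f_incr.
by apply/negbTE; rewrite -leqNgt ltnW // f_incr.
Qed.

Lemma incr_inj : injective f.
Proof.
move=> x y e; apply/val_inj/eqP.
by rewrite eqn_leq [(x <= y)%N]leqNgt [(y <= x)%N]leqNgt -!incr_mono e ltnn.
Qed.

Lemma push_inj : injective push.
Proof. exact: imset_inj (imset_inj incr_inj). Qed.

Lemma push_partition P : partition (push P) (f @: setT) = partition P setT.
Proof. exact: imset_partition incr_inj. Qed.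

Lemma push_noncrossing P : noncrossing (push P) = noncrossing P.
Proof.
apply/noncrossingP/noncrossingP => nc.
  move=> V W VP WP a b c d ab bc cd aV cV bW dW.
  apply: (imset_inj incr_inj); apply: (nc _ _ _ _ (f a) (f b) (f c) (f d));
    by rewrite ?incr_mono ?imset_f.
move=> _ _ /imsetP[V VP ->] /imsetP[W WP ->] a' b' c' d' ab bc cd
  /imsetP[a aV ea] /imsetP[c cV ec] /imsetP[b bW eb] /imsetP[d dW ed].
move: ab bc cd; rewrite ea eb ec ed !incr_mono => ab bc cd.
by rewrite (nc V W VP WP a b c d).
Qed.

Lemma push_surj (Q : {set {set 'I_N}}) :
  partition Q (f @: setT) -> exists P, Q = push P.
Proof.
move=> partQ; exists [set f @^-1: (B : {set 'I_N}) | B in Q].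
rewrite /push -imset_comp -[LHS]imset_id; apply: eq_in_imset => B BQ /=.
apply/setP => y; apply/idP/imsetP => [yB|[x + ->]]; last by rewrite inE.
have /imsetP[x _ yE] := subsetP (partitionS partQ BQ) y yB.
by exists x; rewrite ?inE -?yE.
Qed.

Lemma enum_push B : enum (f @: B) = map f (enum B).
Proof.
apply: (inj_map val_inj); apply: (irr_sorted_eq ltn_trans ltnn).
- exact: sorted_enum.
- rewrite -map_comp sorted_map; have := sorted_enum B; rewrite sorted_map.
  by apply: sub_sorted => x y /=; rewrite incr_mono.
- move=> y; apply/mapP/mapP => [[x]|[x /mapP[z]]].
    by rewrite mem_enum => /imsetP[z zB ->] ->; exists (f z) => //; rewrite map_f ?mem_enum.
  by rewrite mem_enum => zB -> ->; exists (f z) => //; rewrite mem_enum imset_f.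
Qed.

Lemma multiplicative_ext_push (C : comNzRingType) (A : nzRingType)
    (kappa : seq A -> C) P (s t : seq A) :
  (forall x : 'I_M, t`_x = s`_(f x)) ->
  multiplicative_ext kappa (push P) s = multiplicative_ext kappa P t.
Proof.
move=> ts; rewrite /multiplicative_ext big_imset; last first.
  by move=> B B' _ _; apply: imset_inj; exact: incr_inj.
apply: eq_bigr => B _; congr kappa; rewrite /= enum_push -map_comp.
by apply: eq_map => x /=; rewrite ts.
Qed.

End Transport.

Section RowTransport.
Variables (k m n : nat) (g : 'I_m -> 'I_n).
Hypothesis g_incr : {homo g : u v / (u < v)%N}.
Hypothesis k_gt0 : (0 < k)%N.
Let V := g @: setT.

Lemma lift_rows_subproof (x : 'I_(k * m)) : (k * g (row_of x) + x %% k < k * n)%N.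
Proof.
apply: (@leq_trans (k * (g (row_of x)).+1)); last by rewrite leq_mul2l ltn_ord orbT.
by rewrite mulnS addnC ltn_add2r ltn_mod.
Qed.

(** The increasing map on positions that sends row u to row g u and keeps the
place inside the row. *)
Definition lift_rows (x : 'I_(k * m)) : 'I_(k * n) := Ordinal (lift_rows_subproof x).

Lemma row_of_lift x : row_of (lift_rows x) = g (row_of x).
Proof.
by apply: val_inj; rewrite /= mulnC divnMDl // divn_small ?addn0 // ltn_mod.
Qed.

Lemma lift_rows_mod x : lift_rows x = x %[mod k].
Proof. by rewrite /= mulnC modnMDl modn_mod. Qed.

Lemma lift_rows_incr : {homo lift_rows : x y / (x < y)%N}.
Proof.
move=> x y xy.
have [lt|] := ltnP (row_of x) (row_of y).
  by apply: row_ltn; rewrite !row_of_lift g_incr.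
move=> ge; have e : row_of x = row_of y.
  by apply/val_inj/eqP; rewrite eqn_leq ge /= leq_div2r // ltnW.
rewrite /= e ltn_add2l; move: xy.
have /(congr1 val) /= e' := e.
by rewrite {1}(divn_eq x k) {1}(divn_eq y k) e' ltn_add2l.
Qed.

Lemma lift_rows_range : lift_rows @: setT = thicken k V.
Proof.
apply/setP => y; rewrite inE; apply/imsetP/imsetP => -[x _ e].
  by exists (row_of x) => //; rewrite e row_of_lift.
have lt : (k * x + y %% k < k * m)%N.
  apply: (@leq_trans (k * x.+1)); last by rewrite leq_mul2l ltn_ord orbT.
  by rewrite mulnS addnC ltn_add2r ltn_mod.
exists (Ordinal lt) => //.
have r : row_of (Ordinal lt) = x.
  by apply: val_inj; rewrite /= mulnC divnMDl // divn_small ?addn0 // ltn_mod.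
apply: val_inj; rewrite /= r -e /= (mulnC k x) modnMDl modn_mod.
by rewrite (mulnC k (y %/ k)%N) -divn_eq.
Qed.

Lemma push_saturated (Q : {set {set 'I_(k * m)}}) (U : {set 'I_n}) :
  saturated (push lift_rows Q) (thicken k U) =
  saturated Q (thicken k (g @^-1: U)).
Proof.
apply/saturatedP/saturatedP => H B x y.
  move=> BQ xB yB; have := H (lift_rows @: B) (lift_rows x) (lift_rows y).
  by rewrite !inE !row_of_lift; apply; rewrite imset_f.
move=> /imsetP[B' BQ ->] /imsetP[x' xB ->] /imsetP[y' yB ->].
have := H B' x' y' BQ xB yB.
by rewrite !inE !row_of_lift.
Qed.

Lemma push_connected (Q : {set {set 'I_(k * m)}}) :
  row_connected V (push lift_rows Q) = row_connected setT Q.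
Proof.
have ginj := incr_inj g_incr.
have preK (U : {set 'I_m}) : g @^-1: (g @: U) = U.
  by apply/setP => u; rewrite inE mem_imset.
have imK (U : {set 'I_n}) : U \subset V -> g @: (g @^-1: U) = U.
  move=> /subsetP UV; apply/setP => u; apply/imsetP/idP => [[w]|uU].
    by rewrite inE => wU ->.
  by have /imsetP[w _ e] := UV u uU; exists w; rewrite // inE -e.
apply/row_connectedP/row_connectedP => H U.
  move=> _ US; case: (H (g @: U)).
  - exact/imsetS/subsetT.
  - by rewrite push_saturated preK.
  - by move/eqP; rewrite imset_eq0 => /eqP; left.
  - by move=> e; right; rewrite -(preK U) e preK.
move=> UV; rewrite push_saturated => /(H _ (subsetT _)) [] e.
  by left; rewrite -(imK U UV) e imset0.
by right; rewrite -(imK U UV) e.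
Qed.

Lemma row_NC_push : row_NC k V = push lift_rows @: row_NC k setT.
Proof.
have incr := lift_rows_incr.
have E Q : (push lift_rows Q \in row_NC k V) = (Q \in row_NC k setT).
  rewrite !inE -lift_rows_range push_partition // push_noncrossing //.
  by rewrite push_connected thickenT.
apply/setP => Q; apply/idP/imsetP => [QV|[Q' Q'T ->]]; last by rewrite E.
have [Q' QE] : exists Q', Q = push lift_rows Q'.
  apply: push_surj; rewrite lift_rows_range.
  by move: QV; rewrite inE => /and3P[].
by exists Q'; rewrite // -E -QE.
Qed.

End RowTransport.

(** * Free cumulants of products *)

Lemma row_NC_T k n :
  row_NC k [set: 'I_n] = [set Q in NC (k * n) | row_connected setT Q].
Proof. by apply/setP => Q; rewrite !inE thickenT andbA. Qed.

Section CumulantsOfProducts.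
Variables (C : comNzRingType) (A : nzRingType) (tau : A -> C) (k : nat).
Hypothesis k_gt0 : (0 < k)%N.
Implicit Types (rr : seq (seq A)).

Lemma nth_flatten_rows (x0 : A) rr i : all (fun r => size r == k) rr ->
  nth x0 (flatten rr) i = nth x0 (nth [::] rr (i %/ k)) (i %% k).
Proof.
elim: rr i => [|r rr IH] i /=; first by rewrite !nth_nil.
case/andP => /eqP rk /IH {}IH; rewrite nth_cat rk; case: ltnP => [ik|/subnK <-].
  by rewrite divn_small // modn_small.
by rewrite addnK IH modnDr divnDr ?dvdnn // divnn k_gt0 addn1.
Qed.

Lemma size_flatten_rows rr : all (fun r => size r == k) rr ->
  size (flatten rr) = (k * size rr)%N.
Proof.
elim: rr => [|r rr IH] /=; first by rewrite muln0.
by case/andP => /eqP rk /IH {}IH; rewrite size_cat rk IH mulnS.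
Qed.

Definition subrows n rr (V : {set 'I_n}) : seq (seq A) :=
  [seq nth [::] rr i | i : 'I_n <- enum V].

Lemma sum_row_NC_subrows (kappa : seq A -> C) n rr (V : {set 'I_n}) :
  size rr = n -> all (fun r => size r == k) rr ->
  \sum_(Q in row_NC k V) multiplicative_ext kappa Q (flatten rr) =
  \sum_(Q in row_NC k [set: 'I_(#|V|)])
     multiplicative_ext kappa Q (flatten (subrows rr V)).
Proof.
move=> sz szk.
pose g (i : 'I_(#|V|)) : 'I_n := enum_val i.
have incr : {homo g : u v / (u < v)%N}.
  move=> u v uv; rewrite /g (enum_val_nth (enum_default u) u).
  by rewrite (enum_val_nth (enum_default u) v) nth_enum_lt.
have rangeV : g @: setT = V.
  apply/setP => x; apply/imsetP/idP => [[i _ ->]|xV]; first exact: enum_valP.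
  by exists (enum_rank_in xV x); rewrite /g ?enum_rankK_in.
have szkV : all (fun r => size r == k) (subrows rr V).
  apply/allP => _ /mapP[i _ ->]; apply: (allP szk).
  by rewrite mem_nth // sz.
rewrite -[in LHS]rangeV (row_NC_push incr k_gt0) big_imset; last first.
  by move=> Q Q' _ _; apply/push_inj/lift_rows_incr.
apply: eq_bigr => Q _; apply: multiplicative_ext_push; first exact: lift_rows_incr.
move=> x; rewrite !nth_flatten_rows // lift_rows_mod; congr (nth _ _ _).
have -> : (lift_rows g k_gt0 x %/ k)%N = row_of (lift_rows g k_gt0 x) by [].
rewrite row_of_lift (nth_map (enum_default (row_of x))) -?cardE ?row_subproof //.
Qed.

Lemma moment_cumulant_sum n (s : seq A) : size s = n -> (0 < n)%N ->
  tau (\prod_(x <- s) x) =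
  \sum_(P in NC n) multiplicative_ext (free_cumulant tau) P s.
Proof. by move=> <- /moment_cumulant ->. Qed.

(** The formula of Krawczyk and Speicher, for factors of equal length k.
Grouping the moment-cumulant formula of the long word by row join shows that the
right-hand sides satisfy the moment-cumulant relation of the short word; the terms
of all partitions with at least two blocks agree by induction, hence so do the
remaining ones. *)
Theorem free_cumulant_products n rr :
  size rr = n -> (0 < n)%N -> all (fun r => size r == k) rr ->
  free_cumulant tau [seq \prod_(x <- r) x | r <- rr] =
  \sum_(Q in row_NC k [set: 'I_n])
     multiplicative_ext (free_cumulant tau) Q (flatten rr).
Proof.
elim/ltn_ind: n rr => n IH rr sz n0 szk.
set s := [seq \prod_(x <- r) x | r <- rr].
have sn : size s = n by rewrite size_map.
have : tau (\prod_(x <- s) x) = tau (\prod_(x <- flatten rr) x).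
  by rewrite big_flatten big_map.
rewrite (moment_cumulant_sum sn n0).
have szf : size (flatten rr) = (k * n)%N by rewrite size_flatten_rows // sz.
rewrite (moment_cumulant_sum szf) ?muln_gt0 ?k_gt0 //.
rewrite [RHS](partition_big (@row_join k n) [in NC n]) /=; last first.
  by move=> Q; exact: row_join_NC.
under [RHS]eq_bigr => P PNC do rewrite sum_row_join //.
rewrite (bigD1 [set [set: 'I_n]]) ?NC_one_block //=.
rewrite [RHS](bigD1 [set [set: 'I_n]]) ?NC_one_block //=.
rewrite /multiplicative_ext !big_set1.
have -> : [seq s`_i | i : 'I_n <- enum [set: 'I_n]] = s.
  rewrite enum_setT -enumT (map_comp (nth 0 s) val) val_enum_ord -sn.
  exact: mkseq_nth.
set rest := (X in _ + X = _); set rest' := (X in _ = _ + X).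
suff -> : rest = rest' by move/addIr.
apply: eq_bigr => P /andP[PNC neP]; apply: eq_bigr => V VP.
have lt := NC_block_lt PNC neP VP; have gt := NC_block_gt0 PNC VP.
have := sum_row_NC_subrows (free_cumulant tau) V sz szk.
rewrite /multiplicative_ext => ->.
have szV : size (subrows rr V) = #|V| by rewrite size_map -cardE.
rewrite -(IH _ lt (subrows rr V)) //.
  congr free_cumulant; rewrite -map_comp; apply: eq_map => i /=.
  by rewrite (nth_map [::]) ?sz.
apply/allP => _ /mapP[i _ ->]; apply: (allP szk).
by rewrite mem_nth // sz.
Qed.

End CumulantsOfProducts.

(** * Powers of a product of free elements *)

Section PowersOfFreeProducts.
Variables (C : comNzRingType) (A : nzRingType) (tau : A -> C) (k : nat).
Hypothesis k_gt0 : (0 < k)%N.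
Variable a : k.-tuple A.
Hypothesis free_a : freely_independent tau a.

(** A block meeting two residue classes contributes a mixed cumulant of the
free family. *)
Lemma free_cumulant_part_mixed n (Q : {set {set 'I_(k * n)}}) :
  partition Q setT -> ~~ constant_mod Q ->
  free_cumulant_part tau Q (flatten (nseq n (tval a))) = 0.
Proof.
move=> partQ; rewrite negb_forall => /existsP; case=> i.
rewrite negb_forall => /existsP[j]; rewrite negb_imply => /andP[ij nij].
rewrite /free_cumulant_part /multiplicative_ext.
rewrite (bigD1 (pblock Q i)) ?pblockT_mem //=; set V := pblock Q i in ij *.
pose col (x : 'I_(k * n)) : 'I_k := Ordinal (ltn_pmod x k_gt0).
have iV : i \in V by rewrite pblockT.
rewrite (_ : [seq _ | x <- _] = [seq tnth a c | c <- [seq col x | x <- enum V]]).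
  rewrite free_a ?mul0r //; apply/negP => /(constantP (col i))[c e].
  have colE x : x \in V -> col x = c.
    by rewrite -mem_enum => /(map_f col); rewrite e => /nseqP[].
  by case/eqP: nij; apply: (congr1 val (etrans (colE i iV) (esym (colE j ij)))).
rewrite -map_comp; apply: eq_map => x /=.
rewrite (nth_flatten_rows k_gt0); last by apply/allP => r /nseqP[-> _]; rewrite size_tuple.
by rewrite nth_nseq (row_subproof x) (tnth_nth 0).
Qed.

Lemma sum_NC_kreweras n (c : pred {set {set 'I_n}}) (F : {set {set 'I_n}} -> C) :
  \sum_(Q in NC n | c Q) F Q = \sum_(P in NC n | c (kreweras P)) F (Kr P).
Proof.
rewrite -{1}(kreweras_imset n) big_imset_cond; last exact: kreweras_inj.
by apply: eq_bigr => P /andP[PNC _]; rewrite Kr_kreweras.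
Qed.

(** Only the partitions P whose complement is constant modulo k contribute, so the
two selection criteria need to match on these alone. *)
Lemma sum_free_kreweras n (c : pred {set {set 'I_(k * n)}}) c' :
  (forall P, P \in NC (k * n) -> constant_mod (kreweras P) ->
     c (kreweras P) = c' P) ->
  (forall P, P \in NC (k * n) -> c' P -> constant_mod (kreweras P)) ->
  \sum_(Q in NC (k * n) | c Q)
     free_cumulant_part tau Q (flatten (nseq n (tval a))) =
  \sum_(P in [set P in NC (k * n) | c' P])
     free_cumulant_part tau (Kr P) (flatten (nseq n (tval a))).
Proof.
move=> cc' c'P; rewrite sum_NC_kreweras.
under [RHS]eq_bigl => P do rewrite inE.
rewrite big_mkcondr [RHS]big_mkcondr; apply: eq_bigr => P PNC.
have [cm|ncm] := boolP (constant_mod (kreweras P)); first by rewrite cc'.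
by rewrite Kr_kreweras // free_cumulant_part_mixed ?(NC_partition (kreweras_NC _)) // !if_same.
Qed.

Lemma size_nseq_rows n : all (fun r : seq A => size r == k) (nseq n (tval a)).
Proof. by apply/allP => r /nseqP[-> _]; rewrite size_tuple. Qed.

Theorem moment_power_free_product n : (0 < n)%N ->
  tau ((\prod_(x <- a) x) ^+ n) =
  \sum_(P in NC_divisible k n)
    free_cumulant_part tau (Kr P) (flatten (nseq n (tval a))).
Proof.
move=> n0; have -> : (\prod_(x <- a) x) ^+ n = \prod_(x <- flatten (nseq n (tval a))) x.
  by rewrite big_flatten big_nseq -Monoid.iteropE.
have sz : size (flatten (nseq n (tval a))) = (k * n)%N.
  by rewrite (size_flatten_rows (size_nseq_rows n)) size_nseq.
rewrite (moment_cumulant_sum _ sz) ?muln_gt0 ?k_gt0 //.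
transitivity (\sum_(Q in NC (k * n) | xpredT Q)
    free_cumulant_part tau Q (flatten (nseq n (tval a)))).
  by apply: eq_bigl => Q; rewrite andbT.
apply: sum_free_kreweras => P PNC.
  by move=> cm; apply/esym/forall_inP => V; exact: constant_mod_divisible.
by move=> /forall_inP div; apply: divisible_constant_mod.
Qed.

Theorem free_cumulant_free_product n : (0 < n)%N ->
  free_cumulant tau (nseq n (\prod_(x <- a) x)) =
  \sum_(P in NC_equal k n)
    free_cumulant_part tau (Kr P) (flatten (nseq n (tval a))).
Proof.
move=> n0.
have -> : nseq n (\prod_(x <- a) x) =
    [seq \prod_(x <- r) x | r <- nseq n (tval a)] by rewrite map_nseq.
rewrite (free_cumulant_products tau k_gt0 (size_nseq n _)) ?size_nseq_rows //.
rewrite row_NC_T; under eq_bigl => Q do rewrite inE.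
apply: sum_free_kreweras => P PNC.
  move=> cm; apply/idP/forall_inP => [conn V VP|cardk].
    by apply/eqP; apply: connected_card_block conn VP.
  by apply: card_block_connected => // V /cardk/eqP.
move=> /forall_inP cardk; apply: divisible_constant_mod => // V.
by move=> /cardk/eqP->.
Qed.

End PowersOfFreeProducts.

Theorem theorem1 (R : realType) (S : cstarProbSpace R) (k : nat) (hk : (1 <= k)%N)
    (a : k.-tuple S) (ha : freely_independent (cps_state S) a)
    (n : nat) (hn : (1 <= n)%N) :
  free_cumulant (cps_state S) (nseq n (\prod_(x <- a) x)) =
    \sum_(P in NC_equal k n)
      free_cumulant_part (cps_state S) (Kr P) (flatten (nseq n (tval a))) /\
  cps_state S ((\prod_(x <- a) x) ^+ n) =
    \sum_(P in NC_divisible k n)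
      free_cumulant_part (cps_state S) (Kr P) (flatten (nseq n (tval a))).
Proof.
by split; [exact: free_cumulant_free_product | exact: moment_power_free_product].
Qed.
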